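(* Let $(X_1,d_1)$ and $(X_2,d_2)$ be metric spaces with $X_1\cap X_2=\varnothing$, each with at least three points, let $t>0$, and consider the join $X_1+X_2=(X_1\cup X_2,d^t)$. Then, for any positive integer $k$, $$\dim_k(X_1)+\dim_k(X_2)\leq \dim^t_k(X_1)+\dim^t_k(X_2)\leq \dim^t_k(X_1+X_2).$$
   Context: For a metric space $(X,d)$ and a positive integer $k$, a subset $S\subset X$ is a $k$-metric generator for $(X,d)$ if for any two distinct points $u,v\in X$ there are at least $k$ distinct points $w\in S$ with $d(u,w)\neq d(v,w)$. The $k$-metric dimension of $(X,d)$ is the infimum of $|S|$ over all $k$-metric generators $S$ (with $|S|=+\infty$ for infinite $S$ and $\inf\varnothing=+\infty$). For real $t>0$ and $j=1,2$, $d_j^t(x,y)=\min\{d_j(x,y),2t\}$, which is a metric on $X_j$. The join of $(X_1,d_1)$ and $(X_2,d_2)$ relative to $t$ is the metric space $X_1+X_2=(X_1\cup X_2,d^t)$ where $d^t(u,v)=d_1^t(u,v)$ if $u,v\in X_1$, $d^t(u,v)=d_2^t(u,v)$ if $u,v\in X_2$, and $d^t(u,v)=t$ if one of $u,v$ is in $X_1$ and the other is in $X_2$. $\dim_k(X_j)$, $\dim^t_k(X_j)$ and $\dim^t_k(X_1+X_2)$ denote the $k$-metric dimensions of $(X_j,d_j)$, $(X_j,d_j^t)$ and $(X_1\cup X_2,d^t)$, respectively. *)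

(* Defs.v *)
From HB Require Import structures.
From mathcomp Require Import all_boot all_order all_algebra.
From mathcomp Require Import all_classical all_reals.
From mathcomp Require Import interval_inference ereal topology measure.

Set Implicit Arguments.
Unset Strict Implicit.
Unset Printing Implicit Defensive.

Import Order.TTheory GRing.Theory Num.Theory.

Local Open Scope classical_set_scope.
Local Open Scope card_scope.
Local Open Scope ring_scope.

(* [`I_k #<= A] reads: A has at least k elements. *)
Definition metric_generator (R : realType) (k : nat) (X : metricType R)
    (S : set X) : Prop :=
  forall u v : X, u <> v ->
    `I_k #<= [set w | S w /\ mdist u w <> mdist v w].

(* [counting] is +oo on infinite sets, and [ereal_inf set0 = +oo]. *)
Definition metric_dim (R : realType) (k : nat) (X : metricType R) : \bar R :=
  ereal_inf [set counting S | S in @metric_generator R k X].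

(* A copy of X carrying the metric d^t = min(d, 2t). *)
Definition truncated (R : realType) (t : {posnum R}) (X : metricType R) : Type
  := X.

Section truncated_metric.
Context {R : realType} (t : {posnum R}) (X : metricType R).

HB.instance Definition _ := Choice.on (truncated t X).

Definition truncated_dist (x y : truncated t X) : R :=
  Num.min (@mdist R X x y) (2 * t%:num).

Lemma truncated_distxx x : truncated_dist x x = 0.
Proof. by rewrite /truncated_dist mdistxx min_l// mulr_ge0. Qed.

Lemma truncated_dist_positivity x y : truncated_dist x y = 0 -> x = y.
Proof.
rewrite /truncated_dist; case: (leP (@mdist R X x y)) => _.
  exact: mdist_positivity.
by move/eqP; rewrite mulf_eq0 pnatr_eq0/= gt_eqF.
Qed.

Lemma truncated_dist_sym x y : truncated_dist x y = truncated_dist y x.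
Proof. by rewrite /truncated_dist metric_sym. Qed.

Lemma truncated_dist_triangle y x z :
  truncated_dist x z <= truncated_dist x y + truncated_dist y z.
Proof.
have t2_ge0 : 0 <= 2 * t%:num :> R by rewrite mulr_ge0.
have d_ge0 u v : 0 <= truncated_dist u v by rewrite le_min mdist_ge0.
have d_le2t u v : truncated_dist u v <= 2 * t%:num by rewrite ge_min lexx orbT.
have [xy|xy] := leP (@mdist R X x y) (2 * t%:num); last first.
  rewrite (le_trans (d_le2t x z))// {1}/truncated_dist min_r ?(ltW xy)//.
  by rewrite lerDl.
have [yz|yz] := leP (@mdist R X y z) (2 * t%:num); last first.
  rewrite (le_trans (d_le2t x z))// {2}/truncated_dist min_r ?(ltW yz)//.
  by rewrite lerDr.
rewrite /truncated_dist (min_l xy) (min_l yz).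
by rewrite ge_min metric_triangle.
Qed.

HB.instance Definition _ := isMetric.Build R (truncated t X)
  truncated_distxx truncated_dist_positivity truncated_dist_sym
  truncated_dist_triangle.

End truncated_metric.

(* The disjoint union of X1 and X2 carrying the metric d^t. *)
Definition metric_join (R : realType) (t : {posnum R}) (X1 X2 : metricType R)
  : Type := (X1 + X2)%type.

Section join_metric.
Context {R : realType} (t : {posnum R}) (X1 X2 : metricType R).

HB.instance Definition _ := Choice.copy (metric_join t X1 X2) (X1 + X2)%type.

Definition join_dist (u v : metric_join t X1 X2) : R :=
  match u, v with
  | inl x, inl y => @mdist R (truncated t X1) x y
  | inr x, inr y => @mdist R (truncated t X2) x y
  | _, _ => t%:num
  end.

Lemma join_distxx u : join_dist u u = 0.
Proof. by case: u => x /=; rewrite mdistxx. Qed.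

Lemma join_dist_positivity u v : join_dist u v = 0 -> u = v.
Proof.
have tN0 : t%:num <> 0 :> R by apply/eqP; rewrite gt_eqF.
by case: u v => x [] y //= /mdist_positivity ->.
Qed.

Lemma join_dist_sym u v : join_dist u v = join_dist v u.
Proof. by case: u => x; case: v => y //=; rewrite metric_sym. Qed.

Lemma join_dist_triangle v u w :
  join_dist u w <= join_dist u v + join_dist v w.
Proof.
have le2t (X : metricType R) (x y : X) :
    @mdist R (truncated t X) x y <= t%:num + t%:num.
  by rewrite ge_min mulr_natl mulr2n lexx orbT.
case: u => x; case: v => y; case: w => z /=;
  by rewrite ?metric_triangle ?le2t ?lerDl ?lerDr ?mdist_ge0.
Qed.

HB.instance Definition _ := isMetric.Build R (metric_join t X1 X2)
  join_distxx join_dist_positivity join_dist_sym join_dist_triangle.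

End join_metric.

(* Main.v *)
(* If [min(d, 2t)] separates two points, then so does [d]; and two points on
   one side of the join are both at distance [t] from every point of the other
   side.  Hence a generator of the truncated space generates the original one,
   and the two traces of a generator of the join generate the two truncated
   spaces. *)

Require Import Defs.
From mathcomp Require Import all_boot all_order all_algebra.
From mathcomp Require Import finmap.
From mathcomp Require Import all_classical all_reals.
From mathcomp Require Import interval_inference ereal topology measure.

Import Order.TTheory GRing.Theory Num.Theory.

Local Open Scope classical_set_scope.
Local Open Scope card_scope.
Local Open Scope ring_scope.

Lemma card_fset_set_image (T U : choiceType) (f : T -> U) (A : set T) :
  injective f -> finite_set A -> #|` fset_set (f @` A)| = #|` fset_set A|.
Proof.
move=> fI finA; apply/fcard_eq => //; first exact: finite_image.
by apply: inj_card_eq => x y _ _; exact: fI.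
Qed.

(** The images of the two traces under [inl] and [inr] are disjoint subsets of [S], and injections
    preserve cardinality. An infinite [S] makes the right-hand side [+oo]. *)
Lemma counting_sum (R : realType) (A B : choiceType) (S : set (A + B)) :
  (@counting A R (inl @^-1` S) + @counting B R (inr @^-1` S)
     <= @counting _ R S)%E.
Proof.
have inlI : injective (@inl A B) by move=> x y [].
have inrI : injective (@inr A B) by move=> x y [].
rewrite {3}/counting; case: ifPn => [/asboolP finS|_]; last exact: leey.
have finl : finite_set (@inl A B @^-1` S).
  by apply: finite_preimage => // x y _ _; exact: inlI.
have finr : finite_set (@inr A B @^-1` S).
  by apply: finite_preimage => // x y _ _; exact: inrI.
rewrite /counting !asboolT// -EFinD lee_fin -natrD ler_nat.
rewrite -(card_fset_set_image _ _ _ _ inlI finl).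
rewrite -(card_fset_set_image _ _ _ _ inrI finr).
(* Inclusion-exclusion: the sum becomes the size of the union plus that of the intersection, which
   is then shown to be empty. *)
rewrite -cardfsUI -fset_setU; try exact: finite_image.
rewrite -fset_setI; try exact: finite_image.
have -> : [set inl x | x in inl @^-1` S] `&` [set inr x | x in inr @^-1` S]
    = set0 :> set (A + B).
  by rewrite -subset0 => _ [[x _ <-] [y _]].
rewrite fset_set0 cardfs0 addn0 fsubset_leq_card// -fset_set_sub//.
  by move=> _ [] [x Sx <-].
by rewrite finite_setU; split; exact: finite_image.
Qed.

Section MetricDim.
Context {R : realType}.
Implicit Types (X : metricType R) (t : {posnum R}) (k : nat).

Lemma metric_generator_truncated t k X (S : set X) :
  metric_generator (X := truncated t X) k S -> metric_generator k S.
Proof.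
move=> genS u v uv; apply: card_le_trans (genS u v uv) _.
apply: subset_card_le => w [Sw duv]; split=> // dE; apply: duv.
by congr Num.min.
Qed.

(** Both infima range over subsets of the same carrier with the same counts, but truncation leaves
    fewer generators. *)
Lemma metric_dim_truncated t k X :
  (metric_dim k X <= metric_dim k (truncated t X))%E.
Proof.
apply: le_ereal_inf_tmp => _ [S genS <-]; apply: ereal_inf_lbound.
by exists S => //; exact: metric_generator_truncated genS.
Qed.

Context (t : {posnum R}) (X1 X2 : metricType R) (k : nat).
Variable S : set (metric_join t X1 X2).
Hypothesis genS : metric_generator k S.

Lemma metric_generator_join_inl :
  metric_generator (X := truncated t X1) k (inl @^-1` S).
Proof.
move=> u v uv; have /genS : inl u <> inl v :> metric_join t X1 X2 by case.
(* It suffices that the separating points of [S] lie in the [inl]-image of those of its trace, since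
   an image is no larger than its source. *)
move/card_le_trans; apply; apply: card_le_trans (card_image_le inl _).
(* A point [inr w] separates nothing here: both distances compute to [t]. *)
by apply: subset_card_le => -[w|w] [Sw duv]; [exists w | case: duv].
Qed.

Lemma metric_generator_join_inr :
  metric_generator (X := truncated t X2) k (inr @^-1` S).
Proof.
move=> u v uv; have /genS : inr u <> inr v :> metric_join t X1 X2 by case.
move/card_le_trans; apply; apply: card_le_trans (card_image_le inr _).
by apply: subset_card_le => -[w|w] [Sw duv]; [case: duv | exists w].
Qed.

End MetricDim.

Theorem theorem8p2 (R : realType) (X1 X2 : metricType R)
    (card_X1 : `I_3 #<= [set: X1]) (card_X2 : `I_3 #<= [set: X2])
    (t : {posnum R}) (k : nat) (k_gt0 : (0 < k)%N) :
  (metric_dim k X1 + metric_dim k X2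
     <= metric_dim k (truncated t X1) + metric_dim k (truncated t X2)
     <= metric_dim k (metric_join t X1 X2))%E.
Proof.
rewrite leeD ?metric_dim_truncated//=.
apply: le_ereal_inf_tmp => _ [S genS <-].
(* For each generator [S] of the join, the counts of its two traces bound the two infima
   separately. *)
apply: (le_trans _ (counting_sum R (truncated t X1) (truncated t X2) S)).
apply: leeD; apply: ereal_inf_lbound.
- by exists (inl @^-1` S) => //; exact: metric_generator_join_inl.
- by exists (inr @^-1` S) => //; exact: metric_generator_join_inr.
Qed.
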